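(* Let $A$ and $B$ be complex Banach algebras with $A$ unital, with unit $1$, and let $\Phi:A\to B$ be a linear map. Then the following statements are equivalent: (a) $\Phi$ admits a normalized-pg-inverse; (b) there exists a Jordan homomorphism $T:A\to B$ such that $\Phi=R_{\Phi(1)}\circ T$ and $\Phi(1)B=T(1)B$; (c) there exists a Jordan homomorphism $S:A\to B$ such that $\Phi=L_{\Phi(1)}\circ S$ and $B\Phi(1)=B S(1)$.
   Context: For linear maps $\Phi,\Psi:A\to B$ between complex Banach algebras, $\Psi$ is a pg-inverse (pointwise-generalized-inverse) of $\Phi$ if $\Phi(aba)=\Phi(a)\Psi(b)\Phi(a)$ for all $a,b\in A$. $\Psi$ is a normalized-pg-inverse of $\Phi$ if, in addition, $\Psi(aba)=\Psi(a)\Phi(b)\Psi(a)$ for all $a,b\in A$. No continuity of the maps is assumed. A Jordan homomorphism is a linear map $T:A\to B$ with $T(a^2)=T(a)^2$ for all $a\in A$. For $b\in B$, $L_b(x)=bx$ and $R_b(x)=xb$ ($x\in B$). For $b \in B$, $bB=\{bx:x\in B\}$ and $Bb=\{xb:x\in B\}$. *)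

(* Defs.v *)
From HB Require Import structures.
From mathcomp Require Import all_boot all_order all_algebra complex.
From mathcomp Require Import all_classical all_reals all_analysis.

Set Implicit Arguments.
Unset Strict Implicit.
Unset Printing Implicit Defensive.

Import Order.TTheory GRing.Theory Num.Theory.
Import numFieldNormedType.Exports.

Local Open Scope ring_scope.
Local Open Scope classical_set_scope.

(* Banach algebras need not have a unit, so the product cannot come from the
   ring structures of ssralg, which are all unital. *)
HB.mixin Record CompleteNormedModule_isBanachAlgebra (K : numFieldType) (V : Type)
    of CompleteNormedModule K V := {
  bmul : V -> V -> V ;
  bmulA : associative bmul ;
  bmulDl : left_distributive bmul +%R ;
  bmulDr : right_distributive bmul +%R ;
  bmulZl : forall (k : K) (x y : V), bmul (k *: x) y = k *: bmul x y ;
  bmulZr : forall (k : K) (x y : V), bmul x (k *: y) = k *: bmul x y ;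
  normr_bmul : forall x y : V, `|bmul x y| <= `|x| * `|y| }.

#[short(type="banachAlgType")]
HB.structure Definition BanachAlgebra (K : numFieldType) :=
  {V of CompleteNormedModule K V & CompleteNormedModule_isBanachAlgebra K V}.

Notation "x ** y" := (bmul x y) (at level 40, left associativity) : ring_scope.

Definition is_identity (K : numFieldType) (A : banachAlgType K) (e : A) : Prop :=
  left_id e (@bmul K A) /\ right_id e (@bmul K A).

Section Maps.
Context {K : numFieldType} {A B : banachAlgType K}.

Definition pg_inverse (Phi Psi : {linear A -> B}) : Prop :=
  forall a b : A, Phi (a ** b ** a) = Phi a ** Psi b ** Phi a.

Definition normalized_pg_inverse (Phi Psi : {linear A -> B}) : Prop :=
  pg_inverse Phi Psi /\
  forall a b : A, Psi (a ** b ** a) = Psi a ** Phi b ** Psi a.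

Definition jordan_homomorphism (T : {linear A -> B}) : Prop :=
  forall a : A, T (a ** a) = T a ** T a.

End Maps.

Section Multiplications.
Context {K : numFieldType} {B : banachAlgType K}.

Definition lmult (b : B) : B -> B := fun x => b ** x.
Definition rmult (b : B) : B -> B := fun x => x ** b.

Definition right_multiples (b : B) : set B := [set b ** x | x in [set: B]].
Definition left_multiples (b : B) : set B := [set x ** b | x in [set: B]].

End Multiplications.

(* Main.v *)
Require Import Defs.
From HB Require Import structures.
From mathcomp Require Import all_boot all_order all_algebra complex.
From mathcomp Require Import all_classical all_reals all_analysis.

Set Implicit Arguments.
Unset Strict Implicit.
Unset Printing Implicit Defensive.

Import Order.TTheory GRing.Theory Num.Theory.
Import numFieldNormedType.Exports.

Local Open Scope ring_scope.
Local Open Scope classical_set_scope.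

(** Write p = Phi 1. If Psi is a pg-inverse of Phi and q = Psi 1, then
    Phi a = p (Psi a) p and p q p = p, so p q Phi(.) = Phi = Phi(.) q p, and
    T = Phi(.) q and S = q Phi(.) are Jordan homomorphisms from which Phi is
    recovered by multiplying by p. Conversely, a Jordan homomorphism T satisfies
    T (a b a) = (T a) (T b) (T a), hence T 1 is an idempotent acting as the
    identity on the range of T; the equality p B = (T 1) B yields q with
    p q = T 1, and q T(.) is a normalized pg-inverse of Phi. The argument for S
    is the mirror image. *)

Section LinearMultiplications.
Context {K : numFieldType} {B : banachAlgType K} (b : B).

(** Registered as a linear structure so that composites such as [lmult q \o S] are themselves linear
    maps and can serve as witnesses. *)
Lemma lmult_is_linear : linear (lmult b).
Proof. by move=> k x y; rewrite /lmult bmulDr bmulZr. Qed.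

HB.instance Definition _ :=
  GRing.isLinear.Build K B B _ (lmult b) lmult_is_linear.

Lemma rmult_is_linear : linear (rmult b).
Proof. by move=> k x y; rewrite /rmult bmulDl bmulZl. Qed.

HB.instance Definition _ :=
  GRing.isLinear.Build K B B _ (rmult b) rmult_is_linear.

End LinearMultiplications.

Lemma mulr2n_inj (K : numFieldType) (V : lmodType K) (x y : V) :
  x *+ 2 = y *+ 2 -> x = y.
Proof. by rewrite -(scaler_nat 2 x) -(scaler_nat 2 y) => /scalerI; apply; rewrite pnatr_eq0. Qed.

(** Isolates twice [a ** b ** a] using only squares and anticommutators, which Jordan homomorphisms
    respect. *)
Lemma jordan_triple_product (K : numFieldType) (A : banachAlgType K) (a b : A) :
  a ** (a ** b + b ** a) + (a ** b + b ** a) ** a =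
  (a ** a) ** b + b ** (a ** a) + (a ** b ** a) *+ 2.
Proof.
by rewrite bmulDr bmulDl !bmulA [X in _ + X]addrC addrACA -mulr2n.
Qed.

Section JordanHomomorphism.
Context {K : numFieldType} {A B : banachAlgType K}.
Variables (T : {linear A -> B}) (jordT : jordan_homomorphism T).

Lemma jordan_polarized a b : T (a ** b + b ** a) = T a ** T b + T b ** T a.
Proof.
have /= := jordT (a + b).
rewrite !(bmulDl, bmulDr) !(raddfD T) /= !(bmulDl, bmulDr) !jordT.
(* The two squares cancel from the expansions of [T ((a + b) ** (a + b))], leaving the cross
   terms. *)
by rewrite -!addrA => /addrI; rewrite !addrA => /addIr.
Qed.

Lemma jordan_triple a b : T (a ** b ** a) = T a ** T b ** T a.
Proof.
apply: mulr2n_inj; rewrite -raddfMn /=.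
(* This summand completes both sides to nested anticommutators, in [A] under [T] and in [B]. *)
apply: (@addrI _ (T (a ** a) ** T b + T b ** T (a ** a))).
rewrite -jordan_polarized -raddfD /= -jordan_triple_product.
by rewrite !jordan_polarized jordan_triple_product -jordT.
Qed.

Variables (e : A) (e_id : is_identity e).

Lemma jordan_identity_idem : T e ** T e = T e.
Proof. by rewrite -jordT e_id.1. Qed.

(** The triple identity applied to [e ** a ** e]; idempotence of [T e] then yields the one-sided
    versions. *)
Lemma jordan_identity_corner a : T e ** T a ** T e = T a.
Proof. by rewrite -jordan_triple e_id.1 e_id.2. Qed.

Lemma jordan_identityl a : T e ** T a = T a.
Proof. by rewrite -[T a]jordan_identity_corner !bmulA jordan_identity_idem. Qed.

Lemma jordan_identityr a : T a ** T e = T a.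
Proof. by rewrite -[T a]jordan_identity_corner -!bmulA jordan_identity_idem. Qed.

End JordanHomomorphism.

Section Equivalence.
Context {K : numFieldType} {A B : banachAlgType K}.
Variables (e : A) (e_id : is_identity e) (Phi : {linear A -> B}).

Section FromInverse.
Variables (Psi : {linear A -> B}) (PhiPsi : pg_inverse Phi Psi).

Lemma pg_inverse_sandwich a : Phi e ** Psi a ** Phi e = Phi a.
Proof. by rewrite -PhiPsi e_id.1 e_id.2. Qed.

Lemma pg_inverse_square a : Phi (a ** a) = Phi a ** Psi e ** Phi a.
Proof. by rewrite -PhiPsi e_id.2. Qed.

Lemma pg_inverse_identityl a : Phi e ** Psi e ** Phi a = Phi a.
Proof.
by rewrite -(pg_inverse_sandwich a) !bmulA pg_inverse_sandwich.
Qed.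

Lemma pg_inverse_identityr a : Phi a ** Psi e ** Phi e = Phi a.
Proof.
rewrite -(pg_inverse_sandwich a) -!bmulA.
by rewrite [Phi e ** (Psi e ** _)]bmulA pg_inverse_sandwich.
Qed.

Lemma pg_inverse_rmult_jordan : exists T : {linear A -> B},
  [/\ jordan_homomorphism T, (Phi : A -> B) = rmult (Phi e) \o T &
      right_multiples (Phi e) = right_multiples (T e)].
Proof.
exists (rmult (Psi e) \o Phi); split.
- by move=> a /=; rewrite /rmult pg_inverse_square !bmulA.
- by apply/funext => a /=; rewrite /rmult pg_inverse_identityr.
(* With p = [Phi e] and q = [Psi e], [T e] is p q, so the inclusions are p x = (p q)(p x) and (p q)
   x = p (q x). *)
- apply/seteqP; split=> _ [x _ <-].
  + by exists (Phi e ** x) => //; rewrite bmulA pg_inverse_identityl.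
  + by exists (Psi e ** x) => //; rewrite bmulA.
Qed.

Lemma pg_inverse_lmult_jordan : exists S : {linear A -> B},
  [/\ jordan_homomorphism S, (Phi : A -> B) = lmult (Phi e) \o S &
      left_multiples (Phi e) = left_multiples (S e)].
Proof.
exists (lmult (Psi e) \o Phi); split.
- by move=> a /=; rewrite /lmult pg_inverse_square !bmulA.
- by apply/funext => a /=; rewrite /lmult bmulA pg_inverse_identityl.
- apply/seteqP; split=> _ [x _ <-].
  + by exists (x ** Phi e) => //; rewrite -bmulA [Phi e ** _]bmulA
      pg_inverse_sandwich.
  + by exists (x ** Psi e) => //; rewrite bmulA.
Qed.

End FromInverse.

Lemma rmult_jordan_pg_inverse (T : {linear A -> B}) :
    jordan_homomorphism T -> (Phi : A -> B) = rmult (Phi e) \o T ->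
    right_multiples (Phi e) = right_multiples (T e) ->
  exists Psi : {linear A -> B}, normalized_pg_inverse Phi Psi.
Proof.
move=> jordT PhiT eq_mul.
have PhiE a : Phi a = T a ** Phi e by rewrite {1}PhiT.
(* [B] may lack a unit: [T e] lies among its own right multiples because it is idempotent. *)
have [q _ pq] : right_multiples (Phi e) (T e).
  by rewrite eq_mul; exists (T e) => //; apply: jordan_identity_idem.
have pqT a : Phi e ** (q ** T a) = T a.
  by rewrite bmulA pq jordan_identityl.
have Tpq a : T a ** Phi e ** q = T a.
  by rewrite -bmulA pq jordan_identityr.
exists (lmult q \o T); split=> a b; rewrite /lmult /=.
(* In both identities the inner factor p q equals [T e] and is absorbed by a neighbouring value of
   [T]. *)
- by rewrite PhiE jordan_triple // (PhiE a) !bmulA Tpq.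
- by rewrite jordan_triple // (PhiE b) -!bmulA pqT.
Qed.

Lemma lmult_jordan_pg_inverse (S : {linear A -> B}) :
    jordan_homomorphism S -> (Phi : A -> B) = lmult (Phi e) \o S ->
    left_multiples (Phi e) = left_multiples (S e) ->
  exists Psi : {linear A -> B}, normalized_pg_inverse Phi Psi.
Proof.
move=> jordS PhiS eq_mul.
have PhiE a : Phi a = Phi e ** S a by rewrite {1}PhiS.
have [q _ qp] : left_multiples (Phi e) (S e).
  by rewrite eq_mul; exists (S e) => //; apply: jordan_identity_idem.
have Sqp a : S a ** q ** Phi e = S a.
  by rewrite -bmulA qp jordan_identityr.
have qpS a : q ** (Phi e ** S a) = S a.
  by rewrite bmulA qp jordan_identityl.
exists (rmult q \o S); split=> a b; rewrite /rmult /=.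
- by rewrite PhiE jordan_triple // (PhiE a) -!bmulA qpS.
- by rewrite jordan_triple // (PhiE b) !bmulA Sqp.
Qed.

End Equivalence.

Theorem proposition2p5 (R : realType) (A B : banachAlgType R[i])
    (e : A) (e_id : is_identity e) (Phi : {linear A -> B}) :
  [<-> (exists Psi : {linear A -> B}, normalized_pg_inverse Phi Psi);
       (exists T : {linear A -> B},
          [/\ jordan_homomorphism T,
              (Phi : A -> B) = rmult (Phi e) \o T &
              right_multiples (Phi e) = right_multiples (T e)]);
       (exists S : {linear A -> B},
          [/\ jordan_homomorphism S,
              (Phi : A -> B) = lmult (Phi e) \o S &
              left_multiples (Phi e) = left_multiples (S e)])].
Proof.
tfae.
- by move=> [Psi [PhiPsi _]]; apply: pg_inverse_rmult_jordan PhiPsi.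
- move=> [T [jordT PhiT eq_mul]].
  (* The passage from [T] to [S] goes through a pg-inverse. *)
  have [Psi [PhiPsi _]] := rmult_jordan_pg_inverse e_id jordT PhiT eq_mul.
  exact: pg_inverse_lmult_jordan PhiPsi.
- by move=> [S [jordS PhiS eq_mul]]; apply: lmult_jordan_pg_inverse eq_mul.
Qed.
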